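(* Let $(X,d,T)$ be a topological dynamical system. Then $$h_{top}(X,T)=\lim_{\epsilon\to0}\liminf_{n\to\infty}\frac{1}{n}\log(sp_{FK}(n,\epsilon))=\lim_{\epsilon\to0}\limsup_{n\to\infty}\frac{1}{n}\log(sp_{FK}(n,\epsilon)),$$ $$h_{top}(X,T)=\lim_{\epsilon\to0}\liminf_{n\to\infty}\frac{1}{n}\log(sr_{FK}(n,\epsilon))=\lim_{\epsilon\to0}\limsup_{n\to\infty}\frac{1}{n}\log(sr_{FK}(n,\epsilon)).$$
   Context: A topological dynamical system $(X,d,T)$ (also written $(X,T)$) consists of a compact metric space $X$ with metric $d$ and a continuous map $T:X\to X$. $h_{top}(X,T)$ is its topological entropy. For $x,y\in X$, $\delta>0$ and $n\in\mathbb{N}$, an $(n,\delta)$-match of $x$ and $y$ is an order preserving bijection $\pi:D(\pi)\to R(\pi)$ (i.e. $\pi(i)<\pi(j)$ whenever $i<j$) with $D(\pi),R(\pi)\subset\{0,1,\ldots,n-1\}$ such that $d(T^ix,T^{\pi(i)}y)<\delta$ for every $i\in D(\pi)$. Let $|\pi|$ be the cardinality of $D(\pi)$. Set $$\bar f_{n,\delta}(x,y)=1-\frac{\max\{|\pi|:\pi\text{ is an }(n,\delta)\text{-match of }x\text{ and }y\}}{n},\qquad d_{FK_n}(x,y)=\inf\{\delta>0:\bar f_{n,\delta}(x,y)<\delta\}.$$ For $n\in\mathbb{N}$ and $\epsilon>0$: a subset $E\subset X$ is $FK$-$(n,\epsilon)$ spanning if for every $x\in X$ there is $y\in E$ with $d_{FK_n}(x,y)\le\epsilon$;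 $sp_{FK}(n,\epsilon)$ is the smallest cardinality of an $FK$-$(n,\epsilon)$ spanning set. A subset $F\subset X$ is $FK$-$(n,\epsilon)$ separated if $d_{FK_n}(x,y)>\epsilon$ for all $x\neq y$ in $F$; $sr_{FK}(n,\epsilon)$ is the largest cardinality of an $FK$-$(n,\epsilon)$ separated set. *)

(* Defs.v *)
From HB Require Import structures.
From mathcomp Require Import all_boot all_order all_algebra.
From mathcomp Require Import all_classical all_reals all_analysis.
Set Implicit Arguments.
Unset Strict Implicit.
Unset Printing Implicit Defensive.
Import Order.TTheory GRing.Theory Num.Theory.
Import numFieldNormedType.Exports.
Local Open Scope classical_set_scope.
Local Open Scope ring_scope.

(* Topological entropy in the sense of Adler, Konheim and McAndrew. *)

Definition open_cover (X : topologicalType) (U : set (set X)) : Prop :=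
  (forall A, U A -> open A) /\ \bigcup_(A in U) A = setT.

(* The join of U, T^-1 U, ..., T^-(n-1) U: [f i] is the member of U whose
   preimage under T^i is taken. *)
Definition cover_join (X : Type) (T : X -> X) (U : set (set X)) (n : nat) :
    set (set X) :=
  [set \bigcap_(i in `I_n) (iter i T @^-1` f i) |
     f in [set f : nat -> set X | forall i, (i < n)%N -> U (f i)]].

(* Cardinalities are taken in \bar R, with value +oo on infinite sets, so the
   minima and maxima of cardinalities below are infima and suprema. *)
Definition cover_number (R : realType) (X : Type) (U : set (set X)) : \bar R :=
  ereal_inf [set counting V |
    V in [set V | V `<=` U /\ \bigcup_(A in V) A = setT]].

Definition growth_seq (R : realType) (a : nat -> \bar R) (n : nat) : \bar R :=
  ((n%:R^-1)%:E * lne (a n))%E.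

Definition cover_entropy (R : realType) (X : Type) (T : X -> X)
    (U : set (set X)) : \bar R :=
  limn (growth_seq (fun n => cover_number R (cover_join T U n))).

Definition htop (R : realType) (X : topologicalType) (T : X -> X) : \bar R :=
  ereal_sup [set cover_entropy R T U | U in @open_cover X].

(* A match is encoded by its domain D and a function p of which only the values
   on D matter; its range is p @: D, and monotonicity on D makes p injective
   there. *)
Definition is_match (R : realType) (X : metricType R) (T : X -> X) (n : nat)
    (delta : R) (x y : X) (D : {set 'I_n}) (p : {ffun 'I_n -> 'I_n}) : bool :=
  [forall i in D, forall j in D, (i < j)%N ==> (p i < p j)%N] &&
  [forall i in D, mdist (iter i T x) (iter (p i) T y) < delta].

Definition max_match (R : realType) (X : metricType R) (T : X -> X) (n : nat)
    (delta : R) (x y : X) : nat :=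
  \max_(m : {set 'I_n} * {ffun 'I_n -> 'I_n} |
        is_match T delta x y m.1 m.2) #|m.1|.

Definition fbar (R : realType) (X : metricType R) (T : X -> X) (n : nat)
    (delta : R) (x y : X) : R :=
  1 - (max_match T n delta x y)%:R / n%:R.

Definition dFK (R : realType) (X : metricType R) (T : X -> X) (n : nat)
    (x y : X) : R :=
  inf [set delta | 0 < delta /\ fbar T n delta x y < delta].

Definition FK_spanning (R : realType) (X : metricType R) (T : X -> X) (n : nat)
    (eps : R) (E : set X) : Prop :=
  forall x, exists2 y, E y & dFK T n x y <= eps.

Definition FK_separated (R : realType) (X : metricType R) (T : X -> X) (n : nat)
    (eps : R) (F : set X) : Prop :=
  forall x y, F x -> F y -> x <> y -> eps < dFK T n x y.

Definition spFK (R : realType) (X : metricType R) (T : X -> X) (eps : R)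
    (n : nat) : \bar R :=
  ereal_inf [set counting E | E in FK_spanning T n eps].

Definition srFK (R : realType) (X : metricType R) (T : X -> X) (eps : R)
    (n : nat) : \bar R :=
  ereal_sup [set counting F | F in FK_separated T n eps].

(* Main.v *)
Require Import Defs.
From mathcomp Require Import all_boot all_order all_algebra.
From mathcomp Require Import finmap ring lra.
From mathcomp Require Import all_classical all_reals all_analysis.
Import Order.TTheory GRing.Theory Num.Theory.
Import numFieldNormedType.Exports.
Local Open Scope classical_set_scope.
Local Open Scope ring_scope.

(** Write N(U, n) for the least cardinality of a subcover of the join
    U \/ T^-1 U \/ ... \/ T^-(n-1) U, so that the entropy h(U) of an open
    cover U is lim 1/n log N(U, n), and the topological entropy is the supremum
    of h(U). The FK counts are compared with these numbers, for both
    inequalities by elementary counting.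

    From above. If every member of U has diameter less than eps, two points in
    a common member of the join have eps-close orbits up to time n; the identity
    is then a match, and their FK distance is at most eps. So distinct points of
    a separated set lie in distinct members of any subcover
    ([srFK_le_cover_number]). A separated set of maximal cardinality is
    spanning, because the FK distance is symmetric: the inverse of a match is a
    match ([spFK_le_srFK]). Hence sp <= sr <= N(U, n).

    From below. Let U be any open cover, delta a Lebesgue number of U and E a
    spanning set for some eps < delta. Each x is matched with some y in E by
    an order preserving p : D -> D' missing at most delta n times on either side.
    A member of the join containing x is determined by y, by D and D', and by
    the letters that a finite subcover of U gives to the times outside D:
    since p is the only increasing bijection D -> D' ([match_determined]), the
    orbit of x at a time i in D lies in a member of U attached to T^(p i) y.
    The data other than y form a word of length n over a finite alphabet which
    has a default letter at all but 2 delta n places. An exponential moment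
    bound shows that there are at most exp (n (2 delta s + q e^-s)) such words,
    with q the size of the alphabet and s >= 0 arbitrary ([card_few_letters]).
    Taking s large and then delta small makes the exponent less than eta n, so
    that 1/n log N(U, n) <= eta + 1/n log sp(n, eps)
    ([cover_growth_le_spFK]).

    Two facts on limits finish the proof. The sequence 1/n log N(U, n)
    converges, by subadditivity ([growth_seq_cvg]); and sp(n, eps) decreases
    with eps, so that its lower exponential growth rate tends, as eps decreases
    to 0, to its supremum, which the two comparisons identify with the
    topological entropy ([spFK_liminf_cvg]). The other three rates lie between
    this one and the topological entropy. *)

Set Implicit Arguments.
Unset Strict Implicit.
Unset Printing Implicit Defensive.

(** * Cardinalities *)

Lemma le_counting (R : realType) (S T : choiceType) (A : set S) (B : set T) :
  (A #<= B)%card -> (counting A <= counting B :> \bar R)%E.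
Proof.
move=> AB; rewrite /counting; case: (asboolP (finite_set B)) => [fB|_]; last exact: leey.
have fA : finite_set A by apply: card_le_finite AB fB.
rewrite asboolT// lee_fin ler_nat; apply: geq_card_fset_set.
case/finite_setP: fB => m Bm.
by rewrite (card_fset_set Bm) -(card_le_eqr Bm).
Qed.

Lemma counting_infinite (R : realType) (T : choiceType) (A : set T) :
  infinite_set A -> counting A = +oo%E :> \bar R.
Proof. by move=> infA; rewrite /counting asboolF. Qed.

Lemma counting_ge0 (R : realType) (T : choiceType) (A : set T) :
  (0 <= counting A :> \bar R)%E.
Proof. by rewrite /counting; case: ifP => _; rewrite ?lee_fin ?ler0n ?leey. Qed.

Lemma counting_finset (R : realType) (T : finType) (A : {set T}) :
  counting [set` A] = #|A|%:R%:E :> \bar R.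
Proof.
rewrite /counting asboolT; last exact: finite_finset.
congr (_%:R%:E); apply: card_fset_set.
have -> : [set` A] = [set` [fset x | x in A]%fset].
  by apply/seteqP; split=> x /=; rewrite !inE.
by apply/card_eq_fsetP; rewrite card_imfset//= cardE.
Qed.

Lemma counting_setX (R : realType) (S T : choiceType) (A : set S) (B : set T) :
  finite_set A -> finite_set B ->
  counting (A `*` B) = (counting A * counting B)%E :> \bar R.
Proof.
move=> fA fB; rewrite /counting !asboolT//; last exact: finite_setX.
rewrite fset_setX// -EFinM -natrM; congr (_%:R%:E).
have -> : #|` (fset_set A `*` fset_set B)%fset| =
    size [seq (x, y) | x <- fset_set A, y <- fset_set B].
  apply/perm_size/uniq_perm; rewrite ?fset_uniq//.
    by apply: allpairs_uniq; rewrite ?fset_uniq// => -[? ?] [].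
  move=> -[x y]; rewrite in_fsetM/=.
  by apply/andP/allpairsP => [[xA yB]|[[x' y'] [? ? [-> ->]]]]//; exists (x, y).
by rewrite size_allpairs.
Qed.

(** The values are natural numbers or +oo, so that the infimum is a minimum. *)
Lemma counting_inf_attained (R : realType) (T : choiceType) (P : set (set T)) :
  P !=set0 -> exists2 A, P A & ereal_inf [set counting B | B in P] = counting A :> \bar R.
Proof.
move=> [A0 PA0].
have [|noF] := pselect (exists n, `[< exists2 A, P A & A #= `I_n >]%card).
  move=> exn; case: (ex_minnP exn) => m /asboolP[A PA Am] mmin; exists A => //.
  apply/eqP; rewrite eq_le; apply/andP; split.
    by apply: ereal_inf_lbound; exists A.
  apply: le_ereal_inf_tmp => _ [B PB <-].
  have [/finite_setP[k Bk]|/counting_infinite ->] := pselect (finite_set B); last exact: leey.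
  apply: le_counting; rewrite (card_le_eql Am) (card_le_eqr Bk) card_le_II.
  by apply: mmin; apply/asboolP; exists B.
have inf B : P B -> counting B = +oo%E :> \bar R.
  move=> PB; apply: counting_infinite => /finite_setP[k Bk].
  by apply: noF; exists k; apply/asboolP; exists B.
exists A0 => //; rewrite inf//; apply/eqP; rewrite -leye_eq.
by apply: le_ereal_inf_tmp => _ [B PB <-]; rewrite inf.
Qed.

(** * Subcovers of joins *)

(** The finite subcover is presented as a finite alphabet [K], each point [z]
    being given a letter [c z] whose set [L (c z)] contains it; this is the form
    in which itineraries become words. Lists of sets, directed by inclusion, form
    the filter along which compactness is used. *)
Lemma finite_subcover (X : topologicalType) (U : set (set X)) :
  compact [set: X] -> open_cover U ->
  exists (K : finType) (c : X -> K) (L : K -> set X),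
    forall z, U (L (c z)) /\ L (c z) z.
Proof.
move=> /compact_near_coveringP cptX [openU UT].
pose F := filter_from [set: seq (set X)] (fun s => [set t : seq (set X) | {subset s <= t}]).
have filterF : Filter F.
  apply: filter_from_filter; first by exists [::].
  move=> s t _ _; exists (s ++ t) => // r str.
  by split=> A As; apply: str; rewrite mem_cat As ?orbT.
have [|s _ sX] := cptX _ F (fun s x => exists2 A, A \in s & U A /\ A x) filterF.
  move=> x _; have [A UA Ax] : (\bigcup_(A in U) A) x by rewrite UT.
  have openA : open A by exact: openU.
  exists (A, [set t : seq (set X) | {subset [:: A] <= t}]) => /=.
    by split; [exact: open_nbhs_nbhs|exists [:: A]].
  by move=> [y t] /= [Ay At]; exists A => //; apply: At; rewrite mem_head.
have {}sX z : exists k : seq_sub s, U (val k) /\ (val k : set X) z.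
  by have [A As UAz] := sX s (fun _ => id) z I; exists (SeqSub As).
have /choice[c cP] := sX.
by exists (seq_sub s), c, val.
Qed.

(** This is how upper bounds on cover numbers are obtained: [f x] is an
    itinerary of [x] through the cover, and if it depends only on a code [c x]
    from [C], then the corresponding members of the join form a subcover with at
    most as many members as there are codes. *)
Lemma cover_number_le_code (R : realType) (X : Type) (T : X -> X)
    (U : set (set X)) (n : nat) (K : choiceType) (C : set K) (c : X -> K)
    (f : X -> nat -> set X) :
  (forall x, C (c x)) ->
  (forall x i, (i < n)%N -> U (f x i) /\ f x i (iter i T x)) ->
  (forall x x', c x = c x' -> forall i, (i < n)%N -> f x i = f x' i) ->
  (cover_number R (cover_join T U n) <= counting C)%E.
Proof.
move=> cC fU fc.
pose J x := \bigcap_(i in `I_n) (iter i T @^-1` f x i).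
have Jc x x' : c x = c x' -> J x = J x'.
  by move=> cxx'; apply: eq_bigcapr => i /= ltin; rewrite (fc _ _ cxx').
apply: ge_ereal_inf; exists (counting (range J)).
  exists (range J) => //; split.
    by move=> _ [x _ <-]; exists (f x) => // i ltin; have [] := fU x i ltin.
  rewrite -subTset => x _; exists (J x); first by exists x.
  by move=> i ltin; have [] := fU x i ltin.
apply: le_counting; apply: (@card_le_trans _ _ _ (range c)); last first.
  by apply: subset_card_le => _ [x _ <-].
have [[x0 _]|noX] := pselect (exists x : X, True); last first.
  have -> : range J = set0.
    by rewrite -subset0 => A [x _ _]; apply: noX; exists x.
  exact: card_ge0.
have /choice[r rP] : forall k, exists x, (exists x', c x' = k) -> c x = k.
  move=> k; have [[x xk]|nox] := pselect (exists x', c x' = k); first by exists x.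
  by exists x0 => /nox.
have -> : range J = (J \o r) @` range c.
  apply/seteqP; split=> [_ [x _ <-]|_ [_ [x _ <-] <-]]; last by exists (r (c x)).
  by exists (c x); [exists x | apply: Jc; apply: rP; exists x].
exact: card_image_le.
Qed.

Section entropy.
Variables (R : realType) (X : topologicalType) (T : X -> X) (U : set (set X)).
Hypotheses (cptX : compact [set: X]) (UX : open_cover U).

Let N n : \bar R := cover_number R (cover_join T U n).

Lemma cover_number_attained n : exists2 V : set (set X),
  V `<=` cover_join T U n /\ \bigcup_(A in V) A = setT & N n = counting V.
Proof.
apply: counting_inf_attained; exists (cover_join T U n); split => //.
have [K [c [L cL]]] := finite_subcover cptX UX.
rewrite -subTset => x _.
exists (\bigcap_(i in `I_n) (iter i T @^-1` L (c (iter i T x)))).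
  by exists (fun i => L (c (iter i T x))) => // i _; have [] := cL (iter i T x).
by move=> i _; have [] := cL (iter i T x).
Qed.

(** An itinerary through a finite subcover is a word over a finite alphabet. *)
Lemma cover_number_ltoo n : (N n < +oo)%E.
Proof.
have [K [c [L cL]]] := finite_subcover cptX UX.
pose w x : {ffun 'I_n -> K} := [ffun i => c (iter (val i) T x)].
apply: (@le_lt_trans _ _ (counting [set` [set: {ffun 'I_n -> K}]%SET])); last first.
  by rewrite counting_finset ltry.
apply: (@cover_number_le_code _ _ _ _ _ _ _ w (fun x i => L (c (iter i T x)))).
- by move=> x /=; rewrite inE.
- by move=> x i _; exact: cL.
- move=> x x' /ffunP eqw i ltin.
  by have := eqw (Ordinal ltin); rewrite !ffunE/= => ->.
Qed.

(** A point is coded by the member of a minimal subcover of the m-fold join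
    containing it, and the member of a minimal subcover of the n-fold join
    containing its m-th iterate. *)
Lemma cover_number_submul m n : (N (m + n) <= N m * N n)%E.
Proof.
have [V [VU VT] NV] := cover_number_attained m.
have [W [WU WT] NW] := cover_number_attained n.
have finN (A : set (set X)) k : N k = counting A -> finite_set A.
  move=> NA; apply: contrapT => /(@counting_infinite R); rewrite -NA => Noo.
  by have := cover_number_ltoo k; rewrite Noo.
have names k : exists nm : set X -> nat -> set X, forall A, cover_join T U k A ->
    forall x i, A x -> (i < k)%N -> U (nm A i) /\ nm A i (iter i T x).
  have /choice[nm nmP] : forall A, exists f : nat -> set X, cover_join T U k A ->
      forall x i, A x -> (i < k)%N -> U (f i) /\ f i (iter i T x); last by exists nm.
  move=> A; have [[f fU <-]|] := pselect (cover_join T U k A); last by exists (fun=> A).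
  by exists f => _ x i fx ltik; split; [exact: fU|exact: fx].
have pick (A : set (set X)) : \bigcup_(B in A) B = setT ->
    exists p : X -> set X, forall x, A (p x) /\ p x x.
  move=> AT; suff /choice[p pP] : forall x, exists B, A B /\ B x by exists p.
  move=> x; have [B AB Bx] : (\bigcup_(B in A) B) x by rewrite AT.
  by exists B.
have [[a aP] [b bP]] := (names m, names n).
have [[p pP] [q qP]] := (pick V VT, pick W WT).
rewrite NV NW -counting_setX; [|exact: finN NV|exact: finN NW].
apply: (@cover_number_le_code _ _ _ _ _ _ _ (fun x => (p x, q (iter m T x)))
  (fun x i => if (i < m)%N then a (p x) i else b (q (iter m T x)) (i - m)%N)).
- by move=> x; split; [have [] := pP x|have [] := qP (iter m T x)].
- move=> x i ltimn; case: ltnP => [ltim|leim].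
    by have [Vp px] := pP x; exact: aP (VU _ Vp) x i px ltim.
  have [Wq qx] := qP (iter m T x).
  have := bP _ (WU _ Wq) _ (i - m)%N qx; rewrite -iterD subnK//; apply.
  by rewrite ltn_subLR.
- by move=> x x' [-> ->].
Qed.

End entropy.

(** * Convergence of the entropy of a cover *)

(** Fekete's lemma: dividing [n] by a fixed [k], subadditivity bounds [u n] by
    [(n %/ k) * u k] up to a constant, so the limit is the infimum of the
    quotients. *)
Lemma fekete_cvgn (R : realType) (u : nat -> R) :
  (forall n, 0 <= u n) -> (forall m n, u (m + n)%N <= u m + u n) ->
  cvgn (fun n => n%:R^-1 * u n).
Proof.
move=> u0 usub; pose S := [set n.+1%:R^-1 * u n.+1 | n in [set: nat]].
have Slb : has_lbound S.
  by exists 0 => _ [n _ <-]; rewrite mulr_ge0// invr_ge0.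
have mulu q m : u (q * m)%N <= u 0%N + q%:R * u m.
  elim: q => [|q IHq]; first by rewrite mul0n mul0r addr0.
  rewrite mulSn (le_trans (usub _ _))// -addn1 natrD mulrDl mul1r.
  by rewrite addrA [leRHS]addrC lerD2l.
apply/cvg_ex; exists (inf S); apply/cvgrPdist_le => /= e e0.
have [||_ [k _ <-] uk] := @inf_adherent _ S (e / 2).
- exact: divr_gt0.
- by split=> //; exists (1%:R^-1 * u 1%N), 0%N.
(* [C] bounds [u 0] plus the contribution of any remainder modulo [k.+1]. *)
pose C := u 0%N + \sum_(r < k.+1) u r.
have C0 : 0 <= C by rewrite addr_ge0// sumr_ge0.
near=> n.
have n0 : (0 < n)%N by near: n; exists 1%N.
have n0R : 0 < n%:R :> R by rewrite ltr0n.
rewrite distrC ger0_norm; last first.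
  by rewrite subr_ge0 ge_inf//; exists n.-1; rewrite ?prednK.
have Cn : C / n%:R <= e / 2.
  rewrite ler_pdivrMr// mulrC -ler_pdivrMr ?divr_gt0//.
  near: n; exact: nbhs_infty_ger.
have un : u n <= (n %/ k.+1)%:R * u k.+1 + C.
  rewrite [in leLHS](divn_eq n k.+1) (le_trans (usub _ _))//.
  rewrite /C addrA [_ + u 0%N]addrC lerD ?mulu//.
  have rk : (n %% k.+1 < k.+1)%N by rewrite ltn_mod.
  by rewrite (bigD1 (Ordinal rk))//= lerDl sumr_ge0.
rewrite lerBlDr mulrC ler_pdivrMr// (le_trans un)//.
have : (n %/ k.+1)%:R * u k.+1 <= n%:R * (inf S + e / 2).
  apply: (@le_trans _ _ (n%:R * (k.+1%:R^-1 * u k.+1))); last by rewrite ler_wpM2l// ltW.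
  rewrite mulrA ler_wpM2r// ler_pdivlMr// -natrM ler_nat; exact: leq_divM.
move: Cn; rewrite ler_pdivrMr// => Cn nk.
rewrite (le_trans (lerD nk Cn))// [e / 2 * _]mulrC -mulrDr mulrC ler_wpM2r//.
by rewrite -addrA -splitr addrC.
Unshelve. all: by end_near. Qed.

(** The logarithm of the cover number is subadditive. A cover number can only
    vanish when the space is empty; submultiplicativity then makes all later ones
    vanish, and the sequence tends to -oo. *)
Lemma growth_seq_cvg (R : realType) (X : topologicalType) (T : X -> X)
    (U : set (set X)) :
  compact [set: X] -> open_cover U ->
  cvgn (growth_seq (fun n => cover_number R (cover_join T U n))).
Proof.
move=> cptX UX; set N := fun n => cover_number R _.
have Nnat n : exists k, N n = k%:R%:E.
  have [V _ NV] := cover_number_attained R T cptX UX n.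
  have := cover_number_ltoo R T cptX UX n; rewrite -/(N n).
  rewrite /N NV /counting; case: ifP => // _ _.
  by exists #|` fset_set V|%fset.
have [[m Nm0]|Npos] := pselect (exists m, N m = 0%E).
  apply/cvg_ex; exists -oo%E; apply: cvg_near_cst.
  near=> n.
  have mn : (m <= n)%N by near: n; exists m.
  have n0 : (0 < n)%N by near: n; exists 1%N.
  have Nn0 : (N n <= 0)%E.
    by have := cover_number_submul R T cptX UX m (n - m); rewrite subnKC// -!/(N _) Nm0 mul0e.
  rewrite /growth_seq le0_lneNy// gt0_muleNy//.
  by rewrite lte_fin invr_gt0 ltr0n.
have N1 n : (1 <= fine (N n)).
  have [k Nk] := Nnat n; rewrite Nk/= ler1n lt0n; apply/eqP => k0.
  by apply: Npos; exists n; rewrite Nk k0.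
have NE n : N n = (fine (N n))%:E by have [k ->] := Nnat n.
have Ngt0 n : 0 < fine (N n) by apply: lt_le_trans (N1 n).
have -> : growth_seq N = (fun n => (n%:R^-1 * ln (fine (N n)))%:E).
  by apply/funext => n; rewrite /growth_seq NE lne_EFin.
have /cvg_ex[l Nl] : cvgn (fun n => n%:R^-1 * ln (fine (N n))).
  apply: (@fekete_cvgn _ (fun n => ln (fine (N n)))) => [n|m n]; first exact: ln_ge0.
  rewrite -lnM ?posrE// ler_ln ?posrE ?mulr_gt0// -lee_fin EFinM -!NE.
  exact: cover_number_submul.
by apply/cvg_ex; exists l%:E; apply: cvg_EFin Nl; apply: nearW.
Unshelve. all: by end_near. Qed.

(** * Words with few non-default letters *)

(** Chernoff's bound. Each counted word contributes at most
    [expR (s * (b - k))], where [k] is the number of its letters other than [a];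
    the sum of [expR (- s * k)] over all words factors into the [n]-th power of
    the sum over one letter, which is at most [1 + #|K| * expR (- s)]. *)
Lemma card_few_letters (R : realType) (n : nat) (K : finType) (a : K) (b s : R) :
  0 <= s ->
  #|[set w : {ffun 'I_n -> K} | (#|[set i | w i != a]|)%:R <= b]%SET|%:R <=
  expR (s * b + #|K|%:R * expR (- s) * n%:R).
Proof.
move=> s0; set W := [set _ | _]%SET.
pose g (k : K) := if k != a then expR (- s) else 1.
have g0 k : 0 <= g k by rewrite /g; case: ifP => // _; exact: expR_ge0.
have gE (w : {ffun 'I_n -> K}) : \prod_i g (w i) = expR (- s * #|[set i | w i != a]%SET|%:R).
  rewrite /g -big_mkcond/= prodr_const expRM_natr; congr (_ ^+ _).
  by apply: eq_card => i; rewrite inE.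
apply: (@le_trans _ _ (\sum_(w : {ffun 'I_n -> K}) expR (s * b) * \prod_i g (w i))).
  rewrite -sum1_card natr_sum big_mkcond/=; apply: ler_sum => w _.
  rewrite gE -expRD; case: ifP => [|_]; last exact: expR_ge0.
  rewrite inE => wb; rewrite -[leLHS]expR0 ler_expR mulNr -mulrBr mulr_ge0// subr_ge0//.
rewrite -mulr_sumr expRD ler_wpM2l ?expR_ge0//.
rewrite -(bigA_distr_bigA (fun (_ : 'I_n) k => g k)) prodr_const card_ord.
rewrite expRM_natr lerXn2r ?nnegrE ?expR_ge0 ?sumr_ge0//.
rewrite (le_trans _ (expR_ge1Dx _))// (bigD1 a)//= {1}/g eqxx lerD2l.
rewrite mulr_natl -sumr_const big_mkcond/=; apply: ler_sum => k _.
by rewrite /g; case: (k =P a) => //= _.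
Qed.

(** * Matches and the FK pseudometric *)

Section FK.
Variables (R : realType) (X : metricType R) (T : X -> X).
Implicit Types (x y : X) (delta eps : R) (n : nat).

Lemma is_matchP n delta x y (D : {set 'I_n}) (p : {ffun 'I_n -> 'I_n}) :
  reflect ({in D &, forall i j : 'I_n, (i < j)%N -> (p i < p j)%N} /\
           {in D, forall i : 'I_n, mdist (iter i T x) (iter (p i) T y) < delta})
    (is_match T delta x y D p).
Proof.
apply: (iffP andP) => -[mono close]; split.
- move=> i j iD jD; have /forall_inP/(_ _ jD)/implyP := forall_inP mono i iD; exact.
- by move=> i iD; exact: (forall_inP close).
- by apply/forall_inP => i iD; apply/forall_inP => j jD; apply/implyP; exact: mono.
- by apply/forall_inP.
Qed.

Lemma match_inj n delta x y (D : {set 'I_n}) (p : {ffun 'I_n -> 'I_n}) :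
  is_match T delta x y D p -> {in D &, injective p}.
Proof.
move=> /is_matchP[mono _] i j iD jD pij.
by case: (ltngtP i j) => [/(mono _ _ iD jD)|/(mono _ _ jD iD)|/val_inj//];
  rewrite pij ltnn.
Qed.

Lemma match_inverse n delta x y (D : {set 'I_n}) (p : {ffun 'I_n -> 'I_n}) :
  is_match T delta x y D p -> exists q, is_match T delta y x (p @: D) q.
Proof.
move=> pm; have /is_matchP[mono close] := pm; have pinj := match_inj pm.
exists [ffun r => odflt r [pick i in D | p i == r]].
have qp i : i \in D -> odflt (p i) [pick j in D | p j == p i] = i.
  move=> iD; case: pickP => [j /andP[jD /eqP pji]|/(_ i)]; first exact: pinj.
  by rewrite iD eqxx.
apply/is_matchP; split.
  move=> _ _ /imsetP[i iD ->] /imsetP[j jD ->]; rewrite !ffunE !qp//.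
  by case: (ltngtP i j) => [//|/(mono _ _ jD iD)|/val_inj->]; [case: ltngtP|rewrite ltnn].
by move=> _ /imsetP[i iD ->]; rewrite ffunE qp// metric_sym close.
Qed.

Lemma leq_max_match n delta x y (D : {set 'I_n}) (p : {ffun 'I_n -> 'I_n}) :
  is_match T delta x y D p -> (#|D| <= max_match T n delta x y)%N.
Proof.
move=> pm; exact: (@leq_bigmax_cond _ (fun m : {set 'I_n} * {ffun 'I_n -> 'I_n} =>
  is_match T delta x y m.1 m.2) (fun m => #|m.1|) (D, p)).
Qed.

Lemma max_match_sym n delta x y :
  max_match T n delta x y = max_match T n delta y x.
Proof.
suff le a b : (max_match T n delta a b <= max_match T n delta b a)%N.
  by apply/eqP; rewrite eqn_leq !le.
apply/bigmax_leqP => -[D p] /= pm; have [q qm] := match_inverse pm.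
by rewrite -(card_in_imset (match_inj pm)); exact: leq_max_match qm.
Qed.

Lemma dFK_sym n x y : dFK T n x y = dFK T n y x.
Proof. by rewrite /dFK /fbar; under eq_set do rewrite max_match_sym. Qed.

Lemma max_match_attained n delta x y :
  exists D p, @is_match R X T n delta x y D p /\ #|D| = max_match T n delta x y.
Proof.
pose P := [pred m : {set 'I_n} * {ffun 'I_n -> 'I_n} | is_match T delta x y m.1 m.2].
have [|[D p] pm e] := @eq_bigmax_cond _ P (fun m => #|m.1|).
  apply/card_gt0P; exists (finset.set0, [ffun i => i]); apply/is_matchP.
  by split=> i; rewrite finset.in_set0.
by exists D, p; split.
Qed.

Lemma dFK_le n delta x y : 0 < delta -> fbar T n delta x y < delta ->
  dFK T n x y <= delta.
Proof. by move=> d0 fd; apply: ge_inf => //; exists 0 => r [/ltW]. Qed.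

Lemma dFK_close n delta x y : (0 < n)%N -> 0 < delta ->
  (forall i, (i < n)%N -> mdist (iter i T x) (iter i T y) < delta) ->
  dFK T n x y <= delta.
Proof.
move=> n0 d0 close; apply: dFK_le => //; apply: le_lt_trans d0.
have: is_match T delta x y [set: 'I_n]%SET [ffun i => i].
  by apply/is_matchP; split=> [i j _ _|i _]; rewrite !ffunE// close.
move=> /leq_max_match; rewrite cardsT card_ord => nm.
by rewrite /fbar subr_le0 ler_pdivlMr ?ltr0n// mul1r ler_nat.
Qed.

(** A near-optimal scale [delta < eps] in the definition of the FK distance
    gives a match that is [eps]-close and misses at most [eps * n] times. *)
Lemma dFK_lt_match n eps x y : (0 < n)%N -> dFK T n x y < eps ->
  exists (D : {set 'I_n}) (p : {ffun 'I_n -> 'I_n}),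
    is_match T eps x y D p /\ #|~: D|%:R <= eps * n%:R.
Proof.
move=> n0 /inf_lt [|delta [d0 fd] de].
  (* At scale 2 the condition holds since [fbar] is at most 1. *)
  exists 2; split => //; rewrite /fbar ltrBlDr ltr_wpDr ?divr_ge0// ltr1n//.
have [D [p [/is_matchP[mono close] cD]]] := max_match_attained n delta x y.
exists D, p; split.
  by apply/is_matchP; split=> // i iD; apply: lt_trans (close i iD) de.
have n0R : 0 < n%:R :> R by rewrite ltr0n.
have /(congr1 (fun k => k%:R : R)) := cardsC D; rewrite natrD card_ord => nE.
have : #|D|%:R / n%:R * n%:R = #|D|%:R :> R by rewrite divfK// gt_eqF.
move: fd; rewrite /fbar -cD; nra.
Qed.

(** An increasing bijection between finite sets is determined by its domain and
    range. If [p] and [q] agree before [i] but [p i < q i], then [p i] is [q j]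
    for some [j < i], so that [p j = q j = p i], against monotonicity. *)
Lemma match_determined n (D : {set 'I_n}) (p q : 'I_n -> 'I_n) :
  {in D &, forall i j : 'I_n, (i < j)%N -> (p i < p j)%N} ->
  {in D &, forall i j : 'I_n, (i < j)%N -> (q i < q j)%N} ->
  p @: D = q @: D -> {in D, p =1 q}.
Proof.
have ge_step (f g : 'I_n -> 'I_n) (i : 'I_n) : i \in D ->
    {in D &, forall j k : 'I_n, (j < k)%N -> (f j < f k)%N} ->
    {in D &, forall j k : 'I_n, (j < k)%N -> (g j < g k)%N} ->
    f @: D = g @: D -> (forall j : 'I_n, j \in D -> (j < i)%N -> f j = g j) ->
    (g i <= f i)%N.
  move=> iD fm gm fg ih; rewrite leqNgt; apply/negP => fgi.
  have: f i \in g @: D by rewrite -fg imset_f.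
  case/imsetP => j jD fij.
  case: (ltngtP j i) => [ji|/(gm _ _ iD jD)|/val_inj ji].
  - by have := fm _ _ jD iD ji; rewrite (ih j jD ji) -fij ltnn.
  - by rewrite -fij ltnNge (ltnW fgi).
  - by move: fgi; rewrite fij ji ltnn.
move=> pm qm pq i; have [m] := ubnP (val i).
elim: m i => // m IHm i; rewrite ltnS => im iD.
have ih (j : 'I_n) : j \in D -> (j < i)%N -> p j = q j.
  by move=> jD ji; apply: IHm => //; exact: leq_trans im.
apply/val_inj/eqP; rewrite eqn_leq !ge_step// => j jD ji.
by rewrite ih.
Qed.

End FK.

(** * Comparison of the FK numbers with the cover numbers *)

(** The existence of a suitable [delta] around each point is a local property
    that holds for small [delta], so compactness makes [delta] uniform. *)
Lemma lebesgue_number (R : realType) (X : metricType R) (U : set (set X)) :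
  compact [set: X] -> open_cover U ->
  exists2 delta : R, 0 < delta & forall x, exists2 A, U A &
    forall y, mdist x y < delta -> A y.
Proof.
move=> /compact_near_coveringP cptX [openU UT].
have near_delta : \forall delta \near (0 : R)^'+, [set: X] `<=`
    [set x | exists2 A, U A & forall y, mdist x y < delta -> A y].
  apply: (cptX R) => x _; have [A UA Ax] : (\bigcup_(A in U) A) x by rewrite UT.
  have := open_nbhs_nbhs (conj (openU _ UA) Ax); rewrite -nbhs_ballE => -[r /= r0 rA].
  have xr : \forall z \near x, mdist x z < r / 2.
    apply/nbhs_ballP; exists (r / 2); first by rewrite /= divr_gt0.
    by move=> z; rewrite ballEmdist.
  near=> z d.
  have zr : mdist x z < r / 2 by near: z.
  have dr : d <= r / 2 by near: d; apply: nbhs_right_le; rewrite divr_gt0.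
  exists A => // y zy; apply: rA; rewrite ballEmdist/=.
  by rewrite (splitr r) (le_lt_trans (metric_triangle _ z _))// ltrD// (lt_le_trans zy).
have [d [dX d0]] := filter_ex (filterI near_delta (nbhs_right_gt 0)).
by exists d => // x; exact: dX.
Unshelve. all: by end_near. Qed.

Section comparison.
Variables (R : realType) (X : metricType R) (T : X -> X).

Definition small_open_sets (eps : R) : set (set X) :=
  [set A | open A /\ forall x y, A x -> A y -> mdist x y < eps].

Lemma small_open_cover eps : 0 < eps -> open_cover (small_open_sets eps).
Proof.
move=> e0; split; first by move=> A [].
have e20 : 0 < eps / 2 by rewrite divr_gt0.
rewrite -subTset => x _; exists (ball x (eps / 2))°; last first.
  exact: nbhsx_ballx.
split; first exact: open_interior.
move=> y z /interior_subset + /interior_subset; rewrite ballEmdist/= => xy xz.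
by rewrite (le_lt_trans (metric_triangle _ x _))// [ltRHS]splitr ltrD// metric_sym.
Qed.

Lemma srFK_le_cover_number n eps : (0 < n)%N -> 0 < eps ->
  (srFK T eps n <= cover_number R (cover_join T (small_open_sets eps) n))%E.
Proof.
move=> n0 e0; apply: ge_ereal_sup => _ [F Fsep <-].
apply: le_ereal_inf_tmp => _ [V [VJ VT] <-]; apply: le_counting.
have /choice[v vP] : forall x, exists A, V A /\ A x.
  by move=> x; have [A VA Ax] : (\bigcup_(A in V) A) x; [rewrite VT|exists A].
apply: (@card_le_trans _ _ _ (v @` F)); last first.
  by apply: subset_card_le => _ [x _ <-]; have [] := vP x.
rewrite (card_le_eqr (inj_card_eq _))// => x y /set_mem Fx /set_mem Fy vxy.
have [[Vx xx] [_ yy]] := (vP x, vP y); rewrite -vxy in yy.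
have [f fU fx] := VJ _ Vx; rewrite -fx in xx yy.
apply: contrapT => /(Fsep _ _ Fx Fy); apply/negP; rewrite -leNgt.
apply: dFK_close => // i ltin; have [_] := fU i ltin.
by apply; [exact: xx|exact: yy].
Qed.

(** A point far from every point of a separated set of maximal cardinality could
    be added to it, since the FK distance is symmetric. The maximum exists as soon
    as the supremum of the cardinalities is finite. *)
Lemma spFK_le_srFK n eps : (0 < n)%N -> 0 < eps ->
  (spFK T eps n <= srFK T eps n)%E.
Proof.
move=> n0 e0; have [->|sroo] := eqVneq (srFK T eps n) +oo%E; first exact: leey.
have sr0 : (0 <= srFK T eps n)%E.
  by apply: le_ereal_sup_tmp; exists (counting (@set0 X)); [exists set0|exact: counting_ge0].
have [r srE r0] : exists2 r, srFK T eps n = r%:E & 0 <= r.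
  by case: (srFK T eps n) sroo sr0 => // r _; exists r.
have sr_ub F : FK_separated T n eps F -> (counting F <= srFK T eps n)%E.
  by move=> Fsep; apply: ereal_sup_ubound; exists F.
pose P m := `[< exists2 F, FK_separated T n eps F & counting F = m%:R%:E :> \bar R >].
have exP : exists m, P m.
  by exists 0%N; apply/asboolP; exists set0 => //; rewrite /counting asboolT// fset_set0.
have boundP m : P m -> (m <= Num.truncn r)%N.
  move=> /asboolP[F /sr_ub + Fm]; rewrite Fm srE lee_fin => mr.
  by rewrite truncn_ge_nat.
case: (ex_maxnP exP boundP) => m /asboolP[F Fsep Fm] mmax.
apply: (@le_trans _ _ (counting F)); last exact: sr_ub.
apply: ereal_inf_lbound; exists F => // x; apply: contrapT => nospan.
have far y : F y -> eps < dFK T n x y.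
  by move=> Fy; rewrite ltNge; apply/negP => xy; apply: nospan; exists y.
have nFx : ~ F x.
  by move=> /far; apply/negP; rewrite -leNgt dFK_close// => i _; rewrite mdistxx.
have fF : finite_set F.
  by apply: contrapT => /(@counting_infinite R); rewrite Fm.
have /mmax : P m.+1; last by rewrite ltnn.
apply/asboolP; exists (x |` F).
  move=> y z [->|Fy] [->|Fz]// yz; first exact: far.
    by rewrite dFK_sym; exact: far.
  exact: Fsep.
move: Fm; rewrite /counting !asboolT//; last by rewrite finite_setU.
move=> [] /(mulrIn (oner_neq0 R)) <-.
rewrite fset_setU1// cardfsU1 in_fset_set// memNset//.
Qed.

(** The main estimate. A point is coded by a point [y] of the spanning set to
    which it is matched and by a word. The letter at time [i] consists of the
    letter of the finite subcover visited at time [i], or [None] if [i] is in the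
    domain of the match, and of a boolean telling whether [i] is missing from the
    range. Non-default letters thus occur only outside the domain or the range. *)
Lemma cover_number_le_spFK (U : set (set X)) (K : finType) (c : X -> K)
    (L : K -> set X) (delta eps : R) n :
  (forall z, U (L (c z)) /\ L (c z) z) ->
  (forall x, exists2 A, U A & forall y, mdist x y < delta -> A y) ->
  0 < eps -> eps < delta -> (0 < n)%N ->
  (cover_number R (cover_join T U n) <= spFK T eps n *
    #|[set w : {ffun 'I_n -> option K * bool} |
       #|[set i | w i != (None, false)]|%:R <= 2 * delta * n%:R :> R]%SET|%:R%:E)%E.
Proof.
move=> cL Udelta e0 ed n0; have d0 := lt_trans e0 ed; set W := [set w : {ffun _ -> _} | _]%SET.
have [|E Esp spE] := @counting_inf_attained R X (FK_spanning T n eps).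
  by exists setT => x; exists x => //; apply: dFK_close => // i _; rewrite mdistxx.
rewrite /spFK spE.
(* If [E] is infinite, the bound is +oo because the constant default word makes
   the second factor positive. *)
have [finE|/(@counting_infinite R)->] := pselect (finite_set E); last first.
  rewrite gt0_mulye ?leey// lte_fin ltr0n; apply/card_gt0P.
  exists [ffun=> (None, false)]; rewrite inE.
  rewrite (_ : [set _ | _]%SET = finset.set0) ?cards0 ?mulr_ge0//.
    by rewrite ltW.
  by apply/setP => i; rewrite !inE ffunE eqxx.
have finW : finite_set [set` W] by exact: finite_finset.
rewrite -counting_finset -counting_setX//.
have /choice[B BP] : forall x, exists A, U A /\ forall y, mdist x y < delta -> A y.
  by move=> x; have [A UA xA] := Udelta x; exists A.
have /choice[t tP] : forall x, exists t : X * {set 'I_n} * {ffun 'I_n -> 'I_n},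
    [/\ E t.1.1, is_match T delta x t.1.1 t.1.2 t.2 & #|~: t.1.2|%:R <= delta * n%:R].
  move=> x; have [y Ey /le_lt_trans/(_ ed) xy] := Esp x.
  by have [D [p [pm cD]]] := dFK_lt_match n0 xy; exists (y, D, p).
pose y x := (t x).1.1; pose D x := (t x).1.2; pose p x := (t x).2.
pose w x : {ffun 'I_n -> option K * bool} :=
  [ffun i => (if i \in D x then None else Some (c (iter i T x)), i \notin p x @: D x)].
pose f x i := if (insub i : option 'I_n) is Some j then
  if j \in D x then B (iter (p x j) T (y x)) else L (c (iter i T x)) else set0.
have fE x (i : 'I_n) : f x i =
    if i \in D x then B (iter (p x i) T (y x)) else L (c (iter i T x)).
  by rewrite /f valK.
apply: (@cover_number_le_code _ _ _ _ _ _ _ (fun x => (y x, w x)) f).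
- move=> x; have [Ey pm cD] := tP x; split => //=; rewrite inE.
  apply: (@le_trans _ _ (#|~: D x| + #|~: (p x @: D x)|)%:R).
    rewrite ler_nat (leq_trans _ (leq_card_setU _ _))// subset_leq_card//.
    apply/fintype.subsetP => i; rewrite !inE ffunE xpair_eqE negb_and.
    by case: (i \in D x) => //=; case: (i \in _).
  rewrite natrD (_ : #|~: (p x @: D x)| = #|~: D x|); first by rewrite /D; lra.
  by rewrite [LHS]cardsCs [RHS]cardsCs !finset.setCK card_in_imset//; exact: match_inj pm.
- move=> x i ltin; have [Ey /is_matchP[_ close] _] := tP x.
  rewrite -[i]/(val (Ordinal ltin)) fE; case: ifPn => [iD|_]; last exact: cL.
  have [UB Bclose] := BP (iter (p x (Ordinal ltin)) T (y x)); split => //.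
  by apply: Bclose; rewrite metric_sym close.
- move=> x x' [yxx' /ffunP wxx'] i ltin.
  have DD : D x = D x'.
    apply/setP => j; have := wxx' j; rewrite !ffunE => -[+ _].
    by case: ifP; case: ifP.
  have RR : p x @: D x = p x' @: D x'.
    by apply/setP => j; have := wxx' j; rewrite !ffunE => -[_ /negb_inj].
  have [_ /is_matchP[px _] _] := tP x; have [_ /is_matchP[px' _] _] := tP x'.
  rewrite -[i]/(val (Ordinal ltin)) !fE -DD; case: ifPn => iD.
    congr (B (iter _ T _)); last exact: yxx'.
    (* The codes agree, so both matches have the same domain and range. *)
    have pD : p x @: D x = p x' @: D x by rewrite RR DD.
    rewrite -[(t x').1.2]/(D x') -DD in px'.
    by rewrite (match_determined px px' pD iD).
  by have := wxx' (Ordinal ltin); rewrite !ffunE -DD (negbTE iD) => -[-> _].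
Qed.

End comparison.

(** * Exponential growth rates *)

Section growth.
Variable R : realType.
Implicit Types a b u v : nat -> \bar R.
Local Open Scope ereal_scope.

Lemma le_lne (x y : \bar R) : 0 <= x -> x <= y -> lne x <= lne y.
Proof.
move=> x0 xy; rewrite lee_lne// in_itv/= leey andbT//.
exact: le_trans xy.
Qed.

(** The case [x = 0], where both sides are -oo, occurs for the empty space. *)
Lemma lneMexpR (x : \bar R) (r : R) : 0 <= x ->
  lne (x * (expR r)%:E) = lne x + r%:E.
Proof.
rewrite le_eqVlt => /predU1P[<-|x0]; first by rewrite mul0e !le0_lneNy.
have xr : x \in `]0, +oo] by rewrite in_itv/= x0 leey.
have er : (expR r)%:E \in `]0, +oo] by rewrite in_itv/= lte_fin expR_gt0 leey.
by rewrite (lneM xr er) lne_EFin ?expR_gt0// expRK.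
Qed.

Lemma le_growth_seq a b n : (0 < n)%N -> 0 <= a n -> a n <= b n ->
  growth_seq a n <= growth_seq b n.
Proof.
by move=> n0 a0 ab; rewrite lee_wpmul2l ?lee_fin// le_lne.
Qed.

Lemma growth_seq0 a : growth_seq a 0 = 0.
Proof. by rewrite /growth_seq invr0 mul0e. Qed.

Lemma le_limn_esup u v : (forall n, u n <= v n) -> limn_esup u <= limn_esup v.
Proof.
move=> uv; apply: le_ereal_inf_tmp => _ [V FV <-]; apply: ge_ereal_inf.
exists (ereal_sup (u @` V)); first by exists V.
apply: ge_ereal_sup => _ [n Vn <-]; apply: le_ereal_sup_tmp.
by exists (v n) => //; exists n.
Qed.

Lemma le_limn_einf u v : (forall n, u n <= v n) -> limn_einf u <= limn_einf v.
Proof. by move=> uv; rewrite leeN2; apply: le_limn_esup => n; rewrite leeN2. Qed.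

End growth.

Section entropy_FK.
Variables (R : realType) (X : metricType R) (T : X -> X).
Hypothesis cptX : compact [set: X].
Local Open Scope ereal_scope.

Lemma cover_number_ge0 (Y : Type) (U : set (set Y)) : 0 <= cover_number R U.
Proof. by apply: le_ereal_inf_tmp => _ [V _ <-]; exact: counting_ge0. Qed.

Lemma spFK_ge0 eps n : 0 <= spFK T eps n.
Proof. by apply: le_ereal_inf_tmp => _ [E _ <-]; exact: counting_ge0. Qed.

Lemma srFK_ge0 eps n : 0 <= srFK T eps n.
Proof.
apply: le_ereal_sup_tmp; exists (counting (@set0 X)); last exact: counting_ge0.
by exists set0.
Qed.

Lemma le_spFK n (eps eps' : R) : (eps <= eps')%R -> spFK T eps' n <= spFK T eps n.
Proof.
move=> ee'; apply: le_ereal_inf_tmp => _ [E Esp <-]; apply: ereal_inf_lbound.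
by exists E => // x; have [y Ey xy] := Esp x; exists y => //; exact: le_trans ee'.
Qed.

(** The exponential rate [s * (2 * delta) + q * expR (- s)] of the number of words
    is made at most [eta] by choosing first [s], then [delta]. *)
Lemma cover_growth_le_spFK (U : set (set X)) (eta : R) : open_cover U -> (0 < eta)%R ->
  \forall eps \near (0 : R)^'+, forall n,
  growth_seq (fun n => cover_number R (cover_join T U n)) n <=
  eta%:E + growth_seq (spFK T eps) n.
Proof.
move=> UX eta0.
have [K [c [L cL]]] := finite_subcover cptX UX.
have [d d0 dU] := lebesgue_number cptX UX.
pose q : R := #|{: option K * bool}|%:R.
(* This [s] satisfies [q * expR (- s) <= eta / 2] since [s <= expR s]. *)
pose s := (2 * q / eta)%R.
have s0 : (0 <= s)%R by rewrite !mulr_ge0// invr_ge0 ltW.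
have s1 : (0 < s + 1)%R by rewrite ltr_wpDl.
have qs : (q * expR (- s) <= eta / 2)%R.
  rewrite expRN ler_pdivrMr ?expR_gt0//.
  apply: (@le_trans _ _ (eta / 2 * s)%R).
    by rewrite le_eqVlt; apply/orP; left; apply/eqP; rewrite /s; field; rewrite gt_eqF.
  rewrite ler_wpM2l ?divr_ge0 ?(ltW eta0)//.
  by rewrite (le_trans _ (expR_ge1Dx s))// lerDr.
pose delta := Num.min d (eta / (4 * (s + 1)))%R.
have delta0 : (0 < delta)%R by rewrite lt_min d0 divr_gt0// mulr_gt0.
have deltas : (s * (2 * delta) <= eta / 2)%R.
  have : (delta * (4 * (s + 1)) <= eta)%R.
    by rewrite -ler_pdivlMr ?mulr_gt0// ge_min lexx orbT.
  by move: delta0; nra.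
have deltaU x : exists2 A, U A & forall y, (mdist x y < delta)%R -> A y.
  have [A UA dA] := dU x; exists A => // y xy; apply: dA.
  by rewrite (lt_le_trans xy)// ge_min lexx.
near=> eps => -[|n']; first by rewrite !growth_seq0 adde0 lee_fin ltW.
set n := n'.+1; have n0 : (0 < n)%N by [].
have e0 : (0 < eps)%R by near: eps; exact: nbhs_right_gt.
have ed : (eps < delta)%R by near: eps; exact: nbhs_right_lt.
have := cover_number_le_spFK T cL deltaU e0 ed n0.
set W := #|_|%:R => NW.
have {}NW : cover_number R (cover_join T U n) <= spFK T eps n * (expR (eta * n%:R))%:E.
  rewrite (le_trans NW)// lee_wpmul2l ?spFK_ge0// lee_fin.
  rewrite (le_trans (card_few_letters _ _ _ s0))// ler_expR -/q.
  by rewrite !mulrA -!mulrDl ler_wpM2r// [leRHS]splitr lerD// -mulrA.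
have n0R : (0 < n%:R :> R)%R by rewrite ltr0n.
rewrite /growth_seq (_ : eta%:E = n%:R^-1%:E * (eta * n%:R)%:E); last first.
  by rewrite -EFinM mulrCA mulVf ?mulr1// gt_eqF.
rewrite -muleDr//.
rewrite lee_wpmul2l ?lee_fin ?invr_ge0//.
rewrite addeC -lneMexpR ?spFK_ge0// le_lne// cover_number_ge0//.
Unshelve. all: by end_near. Qed.

Lemma srFK_growth_le_htop eps : (0 < eps)%R ->
  limn_esup (growth_seq (srFK T eps)) <= htop R T.
Proof.
move=> e0; have UX := @small_open_cover R X eps e0.
apply: (@le_trans _ _ (cover_entropy R T (small_open_sets eps))); last first.
  by apply: ereal_sup_ubound; exists (small_open_sets eps).
rewrite /cover_entropy -(is_cvg_limn_esupE (@growth_seq_cvg R _ T _ cptX UX)).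
apply: le_limn_esup => -[|n]; first by rewrite !growth_seq0.
by rewrite le_growth_seq ?srFK_ge0//; exact: srFK_le_cover_number.
Qed.

Lemma le_growth_FK eps : (0 < eps)%R ->
  forall n, growth_seq (spFK T eps) n <= growth_seq (srFK T eps) n.
Proof.
move=> e0 [|n]; first by rewrite !growth_seq0.
by rewrite le_growth_seq ?spFK_ge0//; exact: spFK_le_srFK.
Qed.

(** The rate is monotone in [eps], so it converges to its supremum. *)
Lemma spFK_liminf_cvg :
  limn_einf (growth_seq (spFK T eps)) @[eps --> 0%R^'+] --> htop R T.
Proof.
set g := fun eps : R => limn_einf (growth_seq (spFK T eps)).
have gmono : {in `]0%R, +oo[ &, {homo g : x y / (x <= y)%R >-> y <= x}}.
  move=> x y _ _ xy; apply: le_limn_einf => -[|n]; first by rewrite !growth_seq0.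
  by rewrite le_growth_seq ?spFK_ge0// le_spFK.
have := @nonincreasing_at_right_cvge R g 0%R +oo%O isT gmono.
suff -> : ereal_sup [set g x | x in `]0%R, +oo[] = htop R T by [].
apply/eqP; rewrite eq_le; apply/andP; split.
  apply: ge_ereal_sup => _ [eps /= + <-]; rewrite in_itv/= andbT => e0.
  apply: le_trans (srFK_growth_le_htop e0); apply: le_trans (limn_einf_sup _).
  by apply: le_limn_einf; exact: le_growth_FK.
apply: ge_ereal_sup => _ [U UX <-]; apply/lee_addgt0Pr => eta eta0.
near (0%R : R)^'+ => eps.
have e0 : (0 < eps)%R by near: eps; exact: nbhs_right_gt.
have Ueps : forall n, growth_seq (fun n => cover_number R (cover_join T U n)) n <=
    eta%:E + growth_seq (spFK T eps) n.
  by near: eps; exact: cover_growth_le_spFK.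
apply: (@le_trans _ _ (eta%:E + g eps)); last first.
  rewrite addeC leeD2r// ereal_sup_ubound//; exists eps => //=.
  by rewrite in_itv/= andbT.
rewrite /cover_entropy -(is_cvg_limn_einfE (@growth_seq_cvg R _ T _ cptX UX)).
by rewrite /g -limn_einf_shift//; exact: le_limn_einf.
Unshelve. all: by end_near. Qed.

End entropy_FK.

Unset Implicit Arguments.

Theorem theorem2p7 (R : realType) (X : metricType R) (T : X -> X)
    (cptX : compact [set: X]) (contT : continuous T) :
  [/\ limn_einf (growth_seq (spFK T eps)) @[eps --> 0^'+] --> htop R T,
      limn_esup (growth_seq (spFK T eps)) @[eps --> 0^'+] --> htop R T,
      limn_einf (growth_seq (srFK T eps)) @[eps --> 0^'+] --> htop R T &
      limn_esup (growth_seq (srFK T eps)) @[eps --> 0^'+] --> htop R T].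
Proof.
have lower := @spFK_liminf_cvg R X T cptX.
have squeeze (g : R -> \bar R) :
    (forall eps, (0 < eps)%R -> limn_einf (growth_seq (spFK T eps)) <= g eps)%E ->
    (forall eps, (0 < eps)%R -> g eps <= limn_esup (growth_seq (srFK T eps)))%E ->
    g eps @[eps --> 0^'+] --> htop R T.
  move=> gl gu; apply: (squeeze_cvge _ lower (@cvg_cst _ _ _ _ _)).
  near=> eps; have e0 : 0 < eps by near: eps; exact: nbhs_right_gt.
  by rewrite gl//= (le_trans (gu _ e0))//; exact: srFK_growth_le_htop.
have spsr := @le_growth_FK R X T.
split; first exact: lower.
- apply: squeeze => eps e0; first exact: limn_einf_sup.
  by apply: le_limn_esup; exact: spsr.
- apply: squeeze => eps e0; last exact: limn_einf_sup.
  by apply: le_limn_einf; exact: spsr.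
- apply: squeeze => eps e0 //; apply: le_trans (limn_einf_sup _).
  by apply: le_limn_einf; exact: spsr.
Unshelve. all: by end_near. Qed.
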